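(* (Non-Commutative Leading Word Criterion.) Let $G=\{g_1,\dots,g_s\}\subseteq K\langle X\rangle\setminus\{0\}$ be the current set of polynomials in an execution of the Buchberger Procedure, at a moment when the new element $g_s$ has just been appended in step (B4). Let $i,j\in\{1,\dots,s\}$ and let ${\rm o}_{i,s}(w_i,w'_i;u_s,u'_s)\in{\rm NTObs}(i,s)$ and ${\rm o}_{j,s}(w_j,w'_j;v_s,v'_s)\in{\rm NTObs}(j,s)$ be two distinct non-trivial obstructions for which there exist words $w,w'\in\langle X\rangle$ with $u_s=wv_s$ and $u'_s=v'_sw'$. Suppose that one of the following conditions is satisfied: (a) $i>j$; (b) $i=j$ and $ww'=1$ and $w_i>_\sigma w_j$. Then the obstruction ${\rm o}_{i,s}(w_i,w'_i;u_s,u'_s)$ can be removed from $\bigcup_{1\le k\le s}{\rm NTObs}(k,s)$ in the execution of the Buchberger Procedure; that is, if in this pass through step (B4) the set $\bigcup_{1\le k\le s}{\rm NTObs}(k,s)\setminus\{{\rm o}_{i,s}(w_i,w'_i;u_s,u'_s)\}$ is appended to $B$ instead of $\bigcup_{1\le k\le s}{\rm NTObs}(k,s)$, then the procedure still enumerates a $\sigma$-Gröbner basis of $I$, and it still stops after finitely many steps with a finite $\sigma$-Gröbner basis of $I$ whenever $I$ has a finite $\sigma$-Gröbner basis.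
   Context: Basic notation. $K$ is a field, $X=\{x_1,\dots,x_n\}$ a finite alphabet, $\langle X\rangle$ the monoid of words in $X$ (product is concatenation, empty word is $1$), and $K\langle X\rangle$ the free associative $K$-algebra. A word ordering is a (total) well-ordering $\sigma$ on $\langle X\rangle$ such that $w_1\ge_\sigma w_2$ implies $w_3w_1w_4\ge_\sigma w_3w_2w_4$ for all words; $\sigma$ is a fixed word ordering. For $f\ne0$, ${\rm Lw}_\sigma(f)$ is the $\sigma$-largest word in the support of $f$ and ${\rm Lc}_\sigma(f)$ its coefficient. A subset $G$ of a two-sided ideal $I$ is a $\sigma$-Gröbner basis of $I$ if $\{{\rm Lw}_\sigma(g)\mid g\in G\setminus\{0\}\}$ generates the two-sided ideal $\langle {\rm Lw}_\sigma(f)\mid f\in I\setminus\{0\}\rangle$. Obstructions. For $G=\{g_1,\dots,g_s\}\subseteq K\langle X\rangle\setminus\{0\}$ let $F_s=(K\langle X\rangle\otimes_KK\langle X\rangle)^s$ be the free two-sided module with canonical basis $e_1,\dots,e_s$. If words satisfy $w_i{\rm Lw}_\sigma(g_i)w'_i=w_j{\rm Lw}_\sigma(g_j)w'_j$, then ${\rm o}_{i,j}(w_i,w'_i;w_j,w'_j)=\frac1{{\rm Lc}_\sigma(g_i)}w_ie_iw'_i-\frac1{{\rm Lc}_\sigma(g_j)}w_je_jw'_j\in F_s$, whenever non-zero, is called an obstruction of $g_i$ and $g_j$; its S-polynomial is $S_{i,j}(w_i,w'_i;w_j,w'_j)=\frac1{{\rm Lc}_\sigma(g_i)}w_ig_iw'_i-\frac1{{\rm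 Lc}_\sigma(g_j)}w_jg_jw'_j$. The obstruction has an overlap if the indicated occurrences of ${\rm Lw}_\sigma(g_i)$ and ${\rm Lw}_\sigma(g_j)$ in the word $w_i{\rm Lw}_\sigma(g_i)w'_i=w_j{\rm Lw}_\sigma(g_j)w'_j$ overlap in a non-empty word (share a letter position); otherwise it has no overlap. For $i\ne j$, an obstruction of $g_i,g_j$ is non-trivial if it has an overlap and is of one of the forms ${\rm o}_{i,j}(w_i,1;1,w'_j)$, ${\rm o}_{i,j}(1,w'_i;w_j,1)$, ${\rm o}_{i,j}(w_i,w'_i;1,1)$, ${\rm o}_{i,j}(1,1;w_j,w'_j)$; an obstruction of $g_i$ with itself is non-trivial if it has an overlap and is of the form ${\rm o}_{i,i}(1,w'_i;w_i,1)$ with $w_i,w'_i\ne1$. ${\rm NTObs}(i,j)$ is the set of non-trivial obstructions of $g_i$ and $g_j$. Normal remainder. ${\rm NR}_{\sigma,G}(f)$ is any polynomial $p$ produced by the division algorithm: start with $p=0$, $v=f$; while $v\ne0$: if ${\rm Lw}_\sigma(v)=w\,{\rm Lw}_\sigma(g_i)w'$ for some $i$ (take the smallest such $i$) and words $w,w'$, replace $v$ by $v-\frac{{\rm Lc}_\sigma(v)}{{\rm Lc}_\sigma(g_i)}wg_iw'$; otherwise move the leading monomial of $v$ from $v$ to $p$. Buchberger Procedure. Input: $s\ge1$ and a set $G=\{g_1,\dots,g_s\}$ of non-zero polynomials generating the two-sided ideal $I$. (B1) Let $B=\bigcup_{1\le i\le j\le s}{\rm NTObs}(i,j)$. (B2)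 If $B=\emptyset$, return $G$. Otherwise select an obstruction in $B$ using a fair strategy (one which ensures that every obstruction is selected eventually) and delete it from $B$. (B3) Compute its S-polynomial $S$ and $S'={\rm NR}_{\sigma,G}(S)$; if $S'=0$ go to (B2). (B4) Increase $s$ by one, append $g_s=S'$ to $G$, append $\bigcup_{1\le i\le s}{\rm NTObs}(i,s)$ to $B$, and go to (B2). The procedure ''enumerates a $\sigma$-Gröbner basis of $I$'' if the set of all polynomials which are in $G$ at some stage is a $\sigma$-Gröbner basis of $I$. *)

(* Defs.v *)
(* MathComp, with multinomials' monalg and mathcomp-classical. *)
From HB Require Import structures.
From mathcomp Require Import all_boot all_order all_algebra.
From mathcomp Require Import finmap.
From mathcomp.multinomials Require Import monalg.
From mathcomp Require Import boolp classical_sets wochoice.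

Set Implicit Arguments.
Unset Strict Implicit.
Unset Printing Implicit Defensive.

Import GRing.Theory.
Local Open Scope ring_scope.
Local Open Scope classical_set_scope.

(* monalg only has these two notations locally *)
Notation "1" := (@mone _) : monom_scope.
Notation "x * y" := (mmul x y) : monom_scope.

(* Words are {fmonom X}, the free monoid on X, and the free associative algebra
   K<X> is its monoid algebra {malg K[{fmonom X}]}; the word w, seen as a
   polynomial, is << w >>. *)

Section Ideal.
Variable A : nzRingType.

Definition ideal_gen (S : set A) : set A :=
  [set f | exists2 r : seq (A * A * A),
      (forall t, t \in r -> S t.1.2) & f = \sum_(t <- r) t.1.1 * t.1.2 * t.2].

End Ideal.

(* [sigma u v] means u <=_sigma v. [well_order] says that every non-empty set
   of words has exactly one minimum, which entails that sigma is reflexive,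
   antisymmetric, transitive and total. *)
Definition word_ordering (X : finType) (sigma : rel {fmonom X}) : Prop :=
  well_order sigma /\
  (forall w1 w2 w3 w4, sigma w2 w1 -> sigma (w3 * w2 * w4)%M (w3 * w1 * w4)%M).

(* The data of o_{i,j}(w_i, w'_i; w_j, w'_j). Indices start at 0: index i refers
   to the entry i of the current list of polynomials. The element of F_s is
   [obs_elt] below; a non-trivial obstruction with i <= j is determined by it, so
   sets of obstructions can be taken to be sets of data. *)
Record obs (X : finType) := Obs {
  oi : nat; oj : nat;
  wi : {fmonom X}; wi' : {fmonom X};
  wj : {fmonom X}; wj' : {fmonom X} }.

Section Groebner.
Variables (K : fieldType) (X : finType) (sigma : rel {fmonom X}).

Local Notation word := {fmonom X}.
Local Notation poly := {malg K[{fmonom X}]}.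

Implicit Types (f g v p : poly) (G : seq poly) (w u : word) (o : obs X).

(* Both are junk at f = 0. *)
Definition Lw f : word := head 1%M (sort (fun u w => sigma w u) (msupp f)).
Definition Lc f : K := f@_(Lw f).

Definition Lw_ideal (S : set poly) : set poly :=
  ideal_gen [set (<< Lw f >> : poly) | f in S `\ 0].

Definition groebner_basis (I S : set poly) : Prop :=
  S `<=` I /\ Lw_ideal S = Lw_ideal I.

(* The words w e_i w' form a K-basis of the free two-sided module F_s. Letting
   i range over all of nat gives a module that contains every F_s, compatibly
   with the inclusions of F_s in F_(s+1) used when G grows. *)
Definition freebimod := {malg K[(word * nat * word)%type]}.

Definition obs_elt G o : freebimod :=
  (Lc G`_(oi o))^-1 *: << (wi o, oi o, wi' o) >>
  - (Lc G`_(oj o))^-1 *: << (wj o, oj o, wj' o) >>.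

Definition Spoly G o : poly :=
  (Lc G`_(oi o))^-1 *: (<< wi o >> * G`_(oi o) * << wi' o >>)
  - (Lc G`_(oj o))^-1 *: (<< wj o >> * G`_(oj o) * << wj' o >>).

Definition obstruction G o : Prop :=
  [/\ (oi o < size G)%N, (oj o < size G)%N,
      (wi o * Lw G`_(oi o) * wi' o = wj o * Lw G`_(oj o) * wj' o)%M
    & obs_elt G o != 0].

Definition has_overlap G o : Prop :=
  exists q : nat,
    (size (wi o) <= q < size (wi o) + size (Lw G`_(oi o)))%N &&
    (size (wj o) <= q < size (wj o) + size (Lw G`_(oj o)))%N.

Definition nontrivial G o : Prop :=
  has_overlap G o /\
  if oi o == oj o then
    [/\ wi o = 1%M, wj' o = 1%M, wi' o <> 1%M & wj o <> 1%M]
  else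
    [\/ wi' o = 1%M /\ wj o = 1%M,
        wi o = 1%M /\ wj' o = 1%M,
        wj o = 1%M /\ wj' o = 1%M
      | wi o = 1%M /\ wi' o = 1%M].

Definition NTObs G (i j : nat) : set (obs X) :=
  [set o | [/\ oi o = i, oj o = j, obstruction G o & nontrivial G o]].

Definition Lw_multiple G v (i : nat) : Prop :=
  (i < size G)%N /\ exists w w', Lw v = (w * Lw G`_i * w')%M.

(* [division G v p r]: the division loop entered with (v, p) can end with r. *)
Inductive division G : poly -> poly -> poly -> Prop :=
| division_end p : division G 0 p p
| division_reduce v p r i w w' :
    v != 0 ->
    Lw_multiple G v i -> (forall k, (k < i)%N -> ~ Lw_multiple G v k) ->
    Lw v = (w * Lw G`_i * w')%M ->
    division G (v - (Lc v / Lc G`_i) *: (<< w >> * G`_i * << w' >>)) p r ->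
    division G v p r
| division_move v p r :
    v != 0 ->
    (forall k, ~ Lw_multiple G v k) ->
    division G (v - << Lc v *g Lw v >>) (p + << Lc v *g Lw v >>) r ->
    division G v p r.

Definition normal_remainder G f r : Prop := division G f 0 r.

Record state := State { basis : seq poly; pending : set (obs X) }.

Definition initial G0 : state :=
  State G0 [set o | exists i j, (i <= j < size G0)%N /\ NTObs G0 i j o].

(* The union of the NTObs(k,s), where g_s is the last entry of G. *)
Definition new_obs G : set (obs X) :=
  [set o | exists2 k, (k < size G)%N & NTObs G k (size G).-1 o].

(* One pass through (B2)-(B4) selecting o. In (B4) the obstructions in R are
   left out of the set appended to B; R = set0 is the Buchberger Procedure. *)
Definition pass (R : set (obs X)) (st : state) o (st' : state) : Prop :=
  pending st o /\
  exists2 S', normal_remainder (basis st) (Spoly (basis st) o) S' &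
    st' = if S' == 0 then State (basis st) (pending st `\ o)
          else let G' := rcons (basis st) S' in
               State G' ((pending st `\ o) `|` (new_obs G' `\` R)).

(* [st k] is the state after k passes, [sel k] the obstruction selected in the
   next pass and [R k] the set removed in its step (B4). An execution that has
   stopped stays in its final state, and [sel] is irrelevant from then on. *)
Record execution (R : nat -> set (obs X)) G0
    (st : nat -> state) (sel : nat -> obs X) : Prop := {
  execution_init : st 0%N = initial G0;
  execution_stop : forall k, pending (st k) = set0 -> st k.+1 = st k;
  execution_pass : forall k, pending (st k) !=set0 ->
    pass (R k) (st k) (sel k) (st k.+1);
  execution_fair : forall k o, pending (st k) o ->
    exists m, [/\ (k <= m)%N, pending (st m) o & sel m = o] }.

Definition enumerates_groebner (I : set poly) (st : nat -> state) : Prop :=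
  groebner_basis I [set g | exists k, g \in basis (st k)].

Definition stops_with_groebner (I : set poly) (st : nat -> state) : Prop :=
  exists k, pending (st k) = set0 /\ groebner_basis I [set` basis (st k)].

Definition has_finite_groebner (I : set poly) : Prop :=
  exists H : seq poly, groebner_basis I [set` H].

End Groebner.

(* Main.v *)
(* The criterion of Buchberger reduces the claim to showing that, for the set of
   all polynomials that ever occur, every S-polynomial S(a, b; c, d) is a linear
   combination of multiples u g v with u Lw(g) v < W, where W is the common word
   a Lw b. For non-trivial obstructions kept in B this holds by fairness and the
   division algorithm; it then holds for all the obstructions of a pair {i, j}
   as soon as it holds for the non-trivial ones.

   The removed obstruction o1 satisfies o1 = w o2 w' + o with o an obstruction
   of g_i and g_j. In case (a), and in case (b), which forces i < s, the pair
   {i, j} does not have o1 among its obstructions. Hence o2 and the pair {i, j}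
   can be resolved without o1, and they resolve o1.

   For termination: once the leading words present divide those of a finite
   Groebner basis, all remainders are 0, no obstruction is ever added, and the
   finitely many pending ones are used up. *)
Require Import Defs.
From mathcomp Require Import all_boot all_order all_algebra.
From mathcomp Require Import finmap.
From mathcomp.multinomials Require Import monalg.
From mathcomp Require Import boolp classical_sets wochoice.

Set Implicit Arguments.
Unset Strict Implicit.
Unset Printing Implicit Defensive.

Import GRing.Theory.
Local Open Scope ring_scope.
Local Open Scope classical_set_scope.

(** * Cancellation and factorisation in the free monoid *)

Section Words.
Variable X : finType.
Implicit Types a b c d u v w : {fmonom X}.

Lemma word_eqP u v : (u : seq X) = v -> u = v.
Proof. by move=> e; apply/eqP; rewrite fmP e. Qed.

Lemma size_wordM u v : size (u * v)%M = (size u + size v)%N.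
Proof. by rewrite fmM size_cat. Qed.

Lemma word_mulI a : injective (fun u => a * u)%M.
Proof.
move=> u v /(congr1 (@fmonom_val X)); rewrite !fmM => /eqP.
by rewrite eqseq_cat // eqxx => /eqP /word_eqP.
Qed.

Lemma word_Imul b : injective (fun u => u * b)%M.
Proof.
move=> u v /(congr1 (@fmonom_val X)); rewrite !fmM => e.
have es : size u = size v.
  by move: (congr1 size e); rewrite !size_cat => /addIn.
by move/eqP: e; rewrite eqseq_cat // => /andP[/eqP/word_eqP].
Qed.

Lemma word_mul2I a b u v : (a * u * b = a * v * b)%M -> u = v.
Proof. by move=> /word_Imul /word_mulI. Qed.

Lemma word_mulr_id u b : (u * b = u)%M -> b = 1%M.
Proof. by rewrite -{2}[u]mulm1 => /word_mulI. Qed.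

Lemma word_mull_id u a : (a * u = u)%M -> a = 1%M.
Proof. by rewrite -{2}[u]mul1m => /word_Imul. Qed.

Lemma word_splitl a b c d : (a * b = c * d)%M -> (size a <= size c)%N ->
  exists2 m, c = (a * m)%M & b = (m * d)%M.
Proof.
move=> e le_ac; exists (FMonom (drop (size a) c)).
  apply: word_eqP; rewrite fmM /= -{1}(cat_take_drop (size a) c); congr (_ ++ _).
  move: (congr1 (@fmonom_val X) e) => /(congr1 (take (size a))).
  by rewrite !fmM take_size_cat // takel_cat.
apply: word_eqP; rewrite fmM /=.
move: (congr1 (@fmonom_val X) e) => /(congr1 (drop (size a))).
rewrite !fmM drop_size_cat // => ->.
rewrite drop_cat; case: ltnP => // le_ca.
have eac : size a = size c by apply/eqP; rewrite eqn_leq le_ac le_ca.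
by rewrite eac subnn drop0 drop_size.
Qed.

Lemma word_splitr a b c d : (a * b = c * d)%M -> (size b <= size d)%N ->
  exists2 m, d = (m * b)%M & a = (c * m)%M.
Proof.
move=> e le_bd; have le_ca : (size c <= size a)%N.
  by rewrite -(leq_add2r (size b)) -[leqRHS]size_wordM e size_wordM leq_add2l.
by have [m -> ->] := word_splitl (esym e) le_ca; exists m.
Qed.

Lemma word_size0 u : size u = 0%N -> u = 1%M.
Proof. exact: fdeg_eq0I. Qed.

Lemma size_word1 : size (1%M : {fmonom X}) = 0%N.
Proof. by rewrite fm1. Qed.

(** By length. A leading word nested in an equal one thus fills it, so the corresponding
    self-obstruction is zero. *)
Lemma word_between u a b : u = (a * u * b)%M -> a = 1%M /\ b = 1%M.
Proof.
move=> /(congr1 (fun v : {fmonom X} => size v)); rewrite !size_wordM => e.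
have e0 : (size a + size b = 0)%N.
  by apply/eqP; rewrite -(eqn_add2r (size u)) {2}e -addnAC.
move/eqP: e0; rewrite addn_eq0 => /andP[/eqP ? /eqP ?].
by split; exact: word_size0.
Qed.

End Words.

(** * Coefficients, supports and two-sided multiples in the monoid algebra *)

Lemma mcoeff_lincomb (T : choiceType) (R : nzRingType) (x y : R)
    (f g : {malg R[T]}) u :
  (x *: f - y *: g)@_u = x * f@_u - y * g@_u.
Proof. by rewrite mcoeffB; congr (_ - _); rewrite mcoeffZ. Qed.

Lemma malgU_lincomb_eq0 (T : choiceType) (R : nzRingType) (x y : R) (u v : T) :
  x != 0 -> x *: << u >> - y *: << v >> = 0 :> {malg R[T]} -> u = v.
Proof.
move=> x0 /(congr1 (mcoeff u)); rewrite mcoeff_lincomb mcoeff0 mcoeffUU mulr1 mcoeffU.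
by case: eqVneq => // _ /eqP; rewrite mulr0 subr0 (negPf x0).
Qed.

Section Bimul.
Variables (K : fieldType) (X : finType).
Implicit Types (f g h : {malg K[{fmonom X}]}) (a b c d u v w : {fmonom X}).

Definition bimul a f b : {malg K[{fmonom X}]} := << a >> * f * << b >>.
#[global] Arguments bimul a%_M f%_R b%_M.

Lemma malgUM x y u v :
  << x *g u >> * << y *g v >> = << x * y *g u * v >> :> {malg K[{fmonom X}]}.
Proof. by rewrite malgM_def fgmulUU. Qed.

Lemma scalerAr_malg (x : K) f g : f * (x *: g) = x *: (f * g).
Proof.
apply/malgP => k; rewrite mcoeffZ [in RHS]mcoeffMl [RHS]mulr_sumr.
(* The support of [x *: g] may be smaller than that of [g], as [x] may be 0, so the product is
   summed over the larger set. *)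
apply: etrans (mcoeffMlw k (fsubset_refl (msupp f)) (msuppZ_le x g)) _.
apply: eq_bigr => k1 _; rewrite mulr_sumr; apply: eq_bigr => k2 _.
by rewrite mcoeffZ mulrCA mulrnAr.
Qed.

Lemma scalerA_mid (x : K) f g h : f * (x *: g) * h = x *: (f * g * h).
Proof. by rewrite scalerAr_malg -scalerAl. Qed.

Lemma bimulD a b f g : bimul a (f + g) b = bimul a f b + bimul a g b.
Proof. by rewrite /bimul mulrDr mulrDl. Qed.

Lemma bimulB a b f g : bimul a (f - g) b = bimul a f b - bimul a g b.
Proof. by rewrite /bimul mulrBr mulrBl. Qed.

Lemma bimulZ a b (x : K) f : bimul a (x *: f) b = x *: bimul a f b.
Proof. by rewrite /bimul scalerAr_malg -scalerAl. Qed.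

Lemma bimul0 a b : bimul a 0 b = 0.
Proof. by rewrite /bimul mulr0 mul0r. Qed.

Lemma bimul11 f : bimul 1 f 1 = f.
Proof. by rewrite /bimul mulr1 mul1r. Qed.

Lemma bimul_comp a b c d f : bimul a (bimul c f d) b = bimul (a * c) f (d * b).
Proof.
have comp (R : nzRingType) (A B C D F AC DB : R) :
  A * C = AC -> D * B = DB -> A * (C * F * D) * B = AC * F * DB.
  by move=> <- <-; rewrite !mulrA.
by apply: comp; rewrite malgUM mulr1.
Qed.

Lemma bimulU a b (x : K) u : bimul a << x *g u >> b = << x *g a * u * b >>.
Proof. by rewrite /bimul !malgUM mul1r mulr1. Qed.

Lemma malgU_scale (x : K) u : << x *g u >> = x *: << u >> :> {malg K[{fmonom X}]}.
Proof. by rewrite -mul_malgC malgUM mulr1 mul1m. Qed.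

Lemma bimulE a b f : bimul a f b = \sum_(u <- msupp f) f@_u *: << a * u * b >>.
Proof.
rewrite {1}[f]monalgE (big_morph (bimul a ^~ b) (bimulD a b) (bimul0 a b)).
by apply: eq_bigr => u _; rewrite bimulU malgU_scale.
Qed.

Lemma mcoeff_bimul a b f u : (bimul a f b)@_(a * u * b) = f@_u.
Proof.
rewrite bimulE raddf_sum /= [in RHS](monalgE f) [in RHS]raddf_sum /=.
apply: eq_bigr => v _; rewrite mcoeffZ !mcoeffU mulr_natr; congr (_ *+ nat_of_bool _).
by apply/eqP/eqP => [/word_mul2I|->].
Qed.

Lemma msupp_bimul a b f v :
  v \in msupp (bimul a f b) -> exists2 u, u \in msupp f & v = (a * u * b)%M.
Proof.
rewrite /bimul => /msuppM_le[k1 [k2 [+ + ->]]].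
rewrite msuppU1 inE => /msuppM_le[k3 [u [+ uf ->]]].
by rewrite msuppU1 inE => /eqP-> /eqP->; exists u.
Qed.

End Bimul.

(** With [k] a leading coefficient and [l] the inverse of another one, the last bracket is an
    S-polynomial: the term in [u] is traded for one in [v]. *)
Lemma split_term (K : fieldType) (V : lmodType K) (x y k l : K) (u v f : V) :
  k != 0 -> x *: u + f - (y + x * k * l) *: v =
  f - y *: v + (x * k) *: (k^-1 *: u - l *: v).
Proof.
move=> k0; rewrite scalerBr !scalerA mulfK // scalerDl opprD.
by rewrite [RHS]addrACA [f + _]addrC.
Qed.

(** Telescoping through [A * F * M * E * D]. The factors [B - E] and [F - L] will be differences of
    a leading word and a monic polynomial, so they have smaller words. *)
Lemma disjoint_split (R : nzRingType) (A B D E F L M : R) :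
  A * F * (M * B * D) - A * L * M * E * D =
  A * F * (M * (B - E)) * D + A * ((F - L) * M) * E * D.
Proof.
rewrite !(mulrBr, mulrBl) !mulrA addrA; congr (_ - _).
by rewrite subrK.
Qed.

(** * Word orderings and leading words *)

Section Criterion.
Variables (K : fieldType) (X : finType) (sigma : rel {fmonom X}).
Hypothesis sigma_ord : word_ordering sigma.
Local Notation word := {fmonom X}.
Local Notation poly := {malg K[{fmonom X}]}.
Local Notation Lw := (Lw sigma).
Local Notation Lc := (Lc sigma).
Implicit Types (f g h : poly) (S : set poly) (P Q : word -> Prop) (G : seq poly).
Implicit Types (a b c d m u v w : word) (x : K) (o : obs X).

Definition wlt u v := sigma u v && (u != v).

Let wo_sigma : wo_chain sigma predT.
Proof. by move=> A _; apply: sigma_ord.1. Qed.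

Lemma word_le_total : total sigma.
Proof. by move=> u v; apply: (wo_chainW wo_sigma). Qed.

Lemma word_le_refl : reflexive sigma.
Proof. by move=> u; apply: (wo_chain_reflexive wo_sigma). Qed.

Lemma word_le_anti : antisymmetric sigma.
Proof. by move=> u v; apply: (wo_chain_antisymmetric wo_sigma). Qed.

(** Look at the minimum of [u], [v], [w]. If it is [v] or [w], antisymmetry identifies [u] with [v]
    or [v] with [w]. *)
Lemma word_le_trans : transitive sigma.
Proof.
move=> v u w uv vw.
have [|z [[+ zmin] _]] := sigma_ord.1 (mem [:: u; v; w]).
  by exists u; rewrite inE eqxx.
have zu := zmin u; have zv := zmin v; have zw := zmin w.
rewrite !inE => /or3P[] /eqP zE; subst z.
- by apply: zw; rewrite !inE eqxx !orbT.
- have /eqP : u == v by apply/eqP/word_le_anti; rewrite uv zu // !inE eqxx.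
  by move=> ->.
- have e : v = w by apply: word_le_anti; rewrite vw zv // !inE eqxx orbT.
  by rewrite -e.
Qed.

Lemma wltNge u v : wlt u v = ~~ sigma v u.
Proof.
rewrite /wlt; case: (boolP (sigma v u)) => [vu|nvu].
  apply/negP => /andP[uv /eqP]; apply; apply: word_le_anti; exact/andP.
have /orP[uv|] := word_le_total u v; last by rewrite (negPf nvu).
by rewrite uv; apply: contraNneq nvu => ->; apply: word_le_refl.
Qed.

Lemma wlt_irr u : wlt u u = false.
Proof. by rewrite /wlt eqxx andbF. Qed.

Lemma le_wlt_trans u v w : sigma u v -> wlt v w -> wlt u w.
Proof. by move=> uv; rewrite !wltNge; apply: contra => wu; apply: word_le_trans uv. Qed.

Lemma word_le_mul a b u v : sigma u v -> sigma (a * u * b)%M (a * v * b)%M.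
Proof. exact: sigma_ord.2. Qed.

Lemma wlt_mul a b u v : wlt u v -> wlt (a * u * b)%M (a * v * b)%M.
Proof.
case/andP=> uv nuv; rewrite /wlt word_le_mul //=.
by apply: contraNneq nuv => /word_mul2I ->.
Qed.

(** A least inaccessible word would have only accessible words below it. *)
Lemma wlt_wf : well_founded wlt.
Proof.
move=> w0; apply: contrapT => nA0.
pose A : {pred {fmonom X}} := fun u => `[< ~ Acc wlt u >].
have [|z [[/asboolP nAz zmin] _]] := sigma_ord.1 A; first by exists w0; apply/asboolP.
apply: nAz; constructor=> y; rewrite wltNge => yz; apply: contrapT => nAy.
by move/negP: yz; apply; apply: zmin; apply/asboolP.
Qed.

(* A word below 1 would have a strictly decreasing sequence of powers. *)
Lemma word_le1 w : sigma 1%M w.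
Proof.
rewrite -[sigma _ _]negbK -wltNge; apply/negP => w1.
pose A : {pred {fmonom X}} := fun u => `[< exists n, u = iter n (mmul w) 1%M >].
have [|z [[/asboolP[n zE] zmin] _]] := sigma_ord.1 A.
  by exists 1%M; apply/asboolP; exists 0%N.
have /zmin : (w * z)%M \in A by apply/asboolP; exists n.+1; rewrite zE.
have := wlt_mul 1%M z w1; rewrite !mul1m => /[swap] zw.
by rewrite wltNge zw.
Qed.

Lemma Lw_max f u : u \in msupp f -> sigma u (Lw f).
Proof.
rewrite /Lw -(mem_sort (fun u w => sigma w u)).
have : sorted (fun u w => sigma w u) (sort (fun u w => sigma w u) (msupp f)).
  by apply: sort_sorted => v w; apply: word_le_total.
case: (sort _ _) => //= w s ws; rewrite inE => /predU1P[->|us].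
  exact: word_le_refl.
have := order_path_min _ ws; move/(_ _)/allP => -> //.
by move=> v1 v2 v3 /[swap]; apply: word_le_trans.
Qed.

Lemma Lw_in f : f != 0 -> Lw f \in msupp f.
Proof.
move=> f0; rewrite /Lw -(mem_sort (fun u w => sigma w u)).
have : sort (fun u w => sigma w u) (msupp f) <> [::].
  move/(congr1 size); rewrite size_sort /= => /size0nil fs.
  move: f0; rewrite -msupp_eq0 => /fset0Pn[u].
  by rewrite -[_ \in _]/(u \in (msupp f : seq _)) fs.
by case: (sort _ _) => //= w s _; rewrite inE eqxx.
Qed.

Lemma Lc_neq0 f : f != 0 -> Lc f != 0.
Proof. by move=> f0; rewrite /Lc mcoeff_neq0 Lw_in. Qed.

Lemma Lw_eq f w :
  w \in msupp f -> (forall u, u \in msupp f -> sigma u w) -> Lw f = w.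
Proof.
move=> wf fw; apply: (word_le_anti); rewrite Lw_max // andbT.
by apply: fw; apply: Lw_in; apply: contraTneq wf => ->; rewrite msupp0 inE.
Qed.

(** * Combinations of two-sided multiples with bounded leading words *)

Lemma msupp_bimul_le g a b u :
  u \in msupp (bimul a g b) -> sigma u (a * Lw g * b)%M.
Proof. by move=> /msupp_bimul[v vg ->]; apply: word_le_mul => //; apply: Lw_max. Qed.

(** [P] bounds the terms before cancellation: [wlt ^~ w] expresses resolution below [w],
    [sigma ^~ w] a representation of height at most [w], and the true predicate mere membership in
    the ideal. *)
Inductive combo S P : poly -> Prop :=
| combo0 : combo S P 0
| combo_cons x a g b f : S g -> P (a * Lw g * b)%M -> combo S P f ->
    combo S P (x *: bimul a g b + f).

Lemma combo1 S P x a g b : S g -> P (a * Lw g * b)%M -> combo S P (x *: bimul a g b).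
Proof. by move=> Sg Pg; rewrite -[_ *: _]addr0; apply: combo_cons => //; apply: combo0. Qed.

Lemma comboD S P f g : combo S P f -> combo S P g -> combo S P (f + g).
Proof.
move=> Cf Cg; elim: Cf => [|x a h b f' Sh Ph _ IH]; first by rewrite add0r.
by rewrite -addrA; apply: combo_cons.
Qed.

Lemma comboZ S P x f : combo S P f -> combo S P (x *: f).
Proof.
elim=> [|y a h b f' Sh Ph _ IH]; first by rewrite scaler0; apply: combo0.
by rewrite scalerDr scalerA; apply: combo_cons.
Qed.

Lemma comboN S P f : combo S P f -> combo S P (- f).
Proof. by rewrite -scaleN1r; apply: comboZ. Qed.

Lemma combo_sum S P (I : eqType) (s : seq I) (F : I -> poly) :
  (forall i, i \in s -> combo S P (F i)) -> combo S P (\sum_(i <- s) F i).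
Proof.
elim: s => [|i s IH] CF; first by rewrite big_nil; apply: combo0.
rewrite big_cons; apply: comboD; first by apply: CF; rewrite inE eqxx.
by apply: IH => k ks; apply: CF; rewrite inE ks orbT.
Qed.

Lemma sub_combo S S' P P' f : S `<=` S' -> (forall u, P u -> P' u) ->
  combo S P f -> combo S' P' f.
Proof.
move=> SS PP; elim=> [|x a h b f' Sh Ph _ IH]; first exact: combo0.
by apply: combo_cons; [apply: SS|apply: PP|].
Qed.

Lemma combo_bimul S P P' a b f : (forall u, P u -> P' (a * u * b)%M) ->
  combo S P f -> combo S P' (bimul a f b).
Proof.
move=> PP; elim=> [|x c h d f' Sh Ph _ IH]; first by rewrite bimul0; apply: combo0.
rewrite bimulD bimulZ bimul_comp; apply: combo_cons => //.
by have := PP _ Ph; rewrite !mulmA.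
Qed.

Lemma combo_bimul_lt S w a b f :
  combo S (wlt ^~ w) f -> combo S (wlt ^~ (a * w * b)%M) (bimul a f b).
Proof. by apply: combo_bimul => u; apply: wlt_mul. Qed.

(** Expanding [h] into its words splits the product into single multiples of [g], whose leading
    words are bounded one by one. *)
Lemma combo_mulr S P a g h b : S g ->
  (forall u, u \in msupp h -> P (a * Lw g * (u * b))%M) ->
  combo S P (<< a >> * g * h * << b >>).
Proof.
move=> Sg Ph; rewrite -mulrA.
have -> : h * << b >> = \sum_(u <- msupp h) h@_u *: << u * b >>.
  have := bimulE 1%M b h; rewrite /bimul mul1r => ->.
  by apply: eq_bigr => u _; rewrite mul1m.
rewrite mulr_sumr; apply: combo_sum => u uh.
by rewrite scalerAr_malg; apply: combo1 => //; apply: Ph.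
Qed.

Lemma combo_mull S P a g h b : S g ->
  (forall u, u \in msupp h -> P (a * u * Lw g * b)%M) ->
  combo S P (<< a >> * h * g * << b >>).
Proof.
move=> Sg Ph.
have -> : << a >> * h = \sum_(u <- msupp h) h@_u *: << a * u >>.
  have := bimulE a 1%M h; rewrite /bimul mulr1 => ->.
  by apply: eq_bigr => u _; rewrite mulm1.
rewrite -mulrA mulr_suml; apply: combo_sum => u uh.
by rewrite -scalerAl mulrA; apply: combo1 => //; apply: Ph.
Qed.

Lemma msupp_combo_le S w f :
  combo S (sigma ^~ w) f -> forall u, u \in msupp f -> sigma u w.
Proof.
elim=> [|x a h b f' Sh Ph _ IH] u; first by rewrite msupp0 inE.
move=> /(fsubsetP (msuppD_le _ _)); rewrite inE => /orP[|/IH //].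
move=> /(fsubsetP (msuppZ_le _ _)) /msupp_bimul_le ?.
exact: word_le_trans Ph.
Qed.

Lemma msupp_combo_lt S w f :
  combo S (wlt ^~ w) f -> forall u, u \in msupp f -> wlt u w.
Proof.
elim=> [|x a h b f' Sh Ph _ IH] u; first by rewrite msupp0 inE.
move=> /(fsubsetP (msuppD_le _ _)); rewrite inE => /orP[|/IH //].
move=> /(fsubsetP (msuppZ_le _ _)) /msupp_bimul_le ?.
exact: le_wlt_trans Ph.
Qed.

(** A finite non-empty combination has a largest term word, which satisfies [P]; the empty one
    accounts for the first alternative. *)
Lemma combo_max S P f : combo S P f ->
  f = 0 \/ exists2 w, P w & combo S (sigma ^~ w) f.
Proof.
elim=> [|x a h b f' Sh Ph _ IH]; first by left.
right; case: IH => [->|[w Pw Cw]].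
  exists (a * Lw h * b)%M => //; rewrite addr0; apply: combo1 => //.
  exact: word_le_refl.
have [le|le] := orP (word_le_total (a * Lw h * b)%M w).
  by exists w => //; apply: combo_cons.
exists (a * Lw h * b)%M => //; apply: combo_cons => //; first exact: word_le_refl.
by apply: sub_combo Cw => // u uw; apply: word_le_trans le.
Qed.

(** * S-polynomials and the descent behind Buchberger's criterion *)

Definition spol f g a b c d : poly :=
  (Lc f)^-1 *: bimul a f b - (Lc g)^-1 *: bimul c g d.
Arguments spol f%_R g%_R (a b c d)%_M.

Lemma spolN f g a b c d : spol g f c d a b = - spol f g a b c d.
Proof. by rewrite /spol opprB. Qed.

Lemma spol_bimul f g a b c d m m' :
  spol f g (m * a) (b * m') (m * c) (d * m') = bimul m (spol f g a b c d) m'.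
Proof. by rewrite /spol bimulB; congr (_ - _); rewrite (bimulZ m) bimul_comp. Qed.

(** The multiple of [g] cancels. The relation between [o1], [o2] and an obstruction of the pair of
    [i] and [j] is an instance. *)
Lemma spol_trans f g h a b c d m m' :
  spol f h a b m m' = spol g h c d m m' + spol f g a b c d.
Proof. by rewrite /spol [RHS]addrC subrKA. Qed.

Lemma spol_refl f a b : spol f f a b a b = 0.
Proof. by rewrite /spol subrr. Qed.

(** All positions are allowed, including those without overlap and those with [f] equal to [g]; this
    is what the descent consumes. *)
Definition critical_pairs S := forall f g a b c d, S f -> S g ->
  (a * Lw f * b = c * Lw g * d)%M ->
  combo S (wlt ^~ (a * Lw f * b)%M) (spol f g a b c d).

Section CriticalPairs.
Variable S : set poly.
Hypothesis S_neq0 : forall g, S g -> g != 0.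
Hypothesis S_pairs : critical_pairs S.

(** Terms whose word is exactly [w] merge into one: replacing such a term by a multiple of another
    costs an S-polynomial, which is resolved below [w]. *)
Lemma combo_le_split w f : combo S (sigma ^~ w) f ->
  combo S (wlt ^~ w) f \/
  exists x a g b, [/\ S g, (a * Lw g * b)%M = w &
    combo S (wlt ^~ w) (f - x *: bimul a g b)].
Proof.
elim=> [|x a g b f' Sg Pg _ IH]; first by left; apply: combo0.
have [e|ne] := eqVneq (a * Lw g * b)%M w; last first.
  have Lg : wlt (a * Lw g * b)%M w by rewrite /wlt Pg.
  case: IH => [Cf'|[y [c [h [d [Sh hw Cf']]]]]]; first by left; apply: combo_cons.
  right; exists y, c, h, d; split=> //; rewrite -addrA; exact: combo_cons.
right; case: IH => [Cf'|[y [c [h [d [Sh hw Cf']]]]]].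
  by exists x, a, g, b; split=> //; rewrite addrAC subrr add0r.
exists (y + x * Lc g * (Lc h)^-1), c, h, d; split; [exact: Sh|exact: hw|].
rewrite split_term ?Lc_neq0 ?S_neq0 //.
apply: (comboD Cf'); apply: comboZ.
by rewrite -e; apply: S_pairs => //; rewrite e hw.
Qed.

(** Well-founded descent on a bound [w] of the terms. Either the bound can be lowered, or one term
    of word [w] with non-zero coefficient remains; then [w] survives and is the leading word of
    [f]. *)
Lemma Lw_combo f P : f != 0 -> combo S P f ->
  exists a g b, S g /\ Lw f = (a * Lw g * b)%M.
Proof.
move=> f0 /combo_max[/eqP|[w _]]; first by rewrite (negPf f0).
elim/(well_founded_ind (wlt_wf)): w => w IH Cf.
have low : combo S (wlt ^~ w) f -> exists a g b, S g /\ Lw f = (a * Lw g * b)%M.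
  by move=> /combo_max[/eqP|[v vw]]; [rewrite (negPf f0)|apply: IH].
have [/low //|[x [a [g [b [Sg gw Cf']]]]]] := combo_le_split Cf.
have [x0|x0] := eqVneq x 0; first by apply: low; move: Cf'; rewrite x0 scale0r subr0.
exists a, g, b; split=> //; rewrite gw; apply: Lw_eq; last exact: msupp_combo_le Cf.
rewrite -mcoeff_neq0.
have : w \notin msupp (f - x *: bimul a g b).
  by apply/negP => /(msupp_combo_lt Cf'); rewrite wlt_irr.
rewrite -mcoeff_eq0 mcoeffB mcoeffZ -{2}gw mcoeff_bimul subr_eq0 => /eqP->.
by rewrite mulf_neq0 //; apply: Lc_neq0; apply: S_neq0.
Qed.

End CriticalPairs.

(** * Reduction of critical pairs to non-trivial obstructions *)

Lemma tail_lt f u : f != 0 -> u \in msupp (<< Lw f >> - (Lc f)^-1 *: f) ->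
  wlt u (Lw f).
Proof.
move=> f0 uf; rewrite /wlt; apply/andP; split.
  move: uf => /(fsubsetP (msuppB_le _ _)); rewrite inE => /orP[].
    by rewrite msuppU1 inE => /eqP->; apply: word_le_refl.
  by move=> /(fsubsetP (msuppZ_le _ _)); apply: Lw_max.
apply: contraTneq uf => ->; rewrite -mcoeff_eq0 mcoeffB mcoeffUU mcoeffZ.
by rewrite mulVf ?subrr // Lc_neq0.
Qed.

(** As 1 is the least word, [g] is a non-zero constant, so each monomial of [f] is a scalar times a
    multiple of [g] with the same word. *)
Lemma combo_const S P f g : S g -> g != 0 -> Lw g = 1%M ->
  (forall u, u \in msupp f -> P u) -> combo S P f.
Proof.
move=> Sg g0 Lg Pf.
have gE : g = << Lc g *g 1%M >>.
  apply/malgP => u; rewrite mcoeffU; case: eqVneq => [<-|u1]; first by rewrite /Defs.Lc Lg.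
  apply: mcoeff_outdom; apply/negP => /(Lw_max); rewrite Lg => ule.
  move/eqP: u1; apply; apply: (word_le_anti).
  by rewrite ule (word_le1).
rewrite [f]monalgE; apply: combo_sum => u uf.
have -> : << f@_u *g u >> = (f@_u / Lc g) *: bimul u g 1.
  have -> : bimul u g 1 = Lc g *: << u >>.
    by rewrite [in LHS]gE bimulU !mulm1 malgU_scale.
  by rewrite scalerA divfK ?Lc_neq0 // malgU_scale.
by apply: combo1 => //; rewrite Lg !mulm1; apply: Pf.
Qed.

(** Both multiples are scaled to coefficient 1 at the common word, which therefore cancels. *)
Lemma spol_lt f g a b c d u : f != 0 -> g != 0 ->
  (a * Lw f * b = c * Lw g * d)%M -> u \in msupp (spol f g a b c d) ->
  wlt u (a * Lw f * b)%M.
Proof.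
move=> f0 g0 e us; rewrite /wlt; apply/andP; split.
  move: us => /(fsubsetP (msuppB_le _ _)); rewrite inE => /orP[].
    by move=> /(fsubsetP (msuppZ_le _ _)) /(msupp_bimul_le).
  by rewrite e => /(fsubsetP (msuppZ_le _ _)) /(msupp_bimul_le).
apply: contraTneq us => ->; rewrite -mcoeff_eq0 /spol mcoeff_lincomb.
by rewrite {2}e !mcoeff_bimul !mulVf ?Lc_neq0 // subrr.
Qed.

(* For monic f and g with leading words u and v,
   f m v - u m g = f m (v - g) + (f - u) m g. *)
Lemma combo_disjoint S f g a m d : S f -> S g -> f != 0 -> g != 0 ->
  combo S (wlt ^~ (a * Lw f * (m * (Lw g * d)))%M)
    (spol f g a (m * (Lw g * d)) (a * Lw f * m) d).
Proof.
move=> Sf Sg f0 g0; rewrite /spol -!bimulZ /bimul.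
have -> : << m * (Lw g * d) >> = << m >> * << Lw g >> * << d >> :> poly.
  by rewrite !malgUM !mulr1 mulmA.
have -> : << a * Lw f * m >> = << a >> * << Lw f >> * << m >> :> poly.
  by rewrite !malgUM !mulr1.
rewrite disjoint_split; apply: comboD.
  rewrite scalerAr_malg -2!scalerAl; apply/comboZ/combo_mulr => // u.
  have -> : << m >> * (<< Lw g >> - (Lc g)^-1 *: g) =
            bimul m (<< Lw g >> - (Lc g)^-1 *: g) 1 by rewrite /bimul mulr1.
  move=> /msupp_bimul[v /(tail_lt g0) vg ->].
  by have := wlt_mul (a * Lw f * m)%M d vg; rewrite mulm1 !mulmA.
rewrite scalerA_mid; apply/comboZ/combo_mull => // u.
have -> : ((Lc f)^-1 *: f - << Lw f >>) * << m >> =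
    - bimul 1 (<< Lw f >> - (Lc f)^-1 *: f) m.
  by rewrite /bimul mul1r -mulNr opprB.
rewrite msuppN => /msupp_bimul[v /(tail_lt f0) vf ->].
by have := wlt_mul a (m * Lw g * d)%M vf; rewrite mul1m !mulmA.
Qed.

(** If the module element vanished, its two basis elements would coincide; a self-obstruction with
    equal left cofactors is excluded, since one of them is 1 and the other is not. *)
Lemma NTObs_intro G i j a b c d (o := Obs i j a b c d) :
  (i < size G)%N -> (j < size G)%N -> G`_i != 0 -> G`_j != 0 ->
  (a * Lw G`_i * b = c * Lw G`_j * d)%M -> nontrivial sigma G o ->
  NTObs sigma G i j o.
Proof.
move=> iG jG gi0 gj0 e nt; split=> //; split=> //.
apply/negP => /eqP; rewrite /obs_elt => /malgU_lincomb_eq0.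
rewrite invr_eq0 Lc_neq0 // => /(_ isT) /= [e1 e2 e3].
by move: nt; rewrite /nontrivial /= e1 e2 e3 eqxx => -[_ [-> _ _]]; case.
Qed.

(** Disjoint occurrences are resolved directly. Otherwise, cancelling the common prefix of [a], [c]
    and the common suffix of [b], [d] leaves zero or, up to sign, a non-trivial obstruction. *)
Lemma critical_pair S G i j : (i < size G)%N -> (j < size G)%N ->
  G`_i != 0 -> G`_j != 0 -> S G`_i -> S G`_j ->
  (forall o, NTObs sigma G i j o ->
     combo S (wlt ^~ (wi o * Lw G`_i * wi' o)%M) (Spoly sigma G o)) ->
  forall a b c d, (a * Lw G`_i * b = c * Lw G`_j * d)%M ->
  combo S (wlt ^~ (a * Lw G`_i * b)%M) (spol G`_i G`_j a b c d).
Proof.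
move=> iG jG gi0 gj0 Si Sj nt a b c d e.
(* An empty leading word never overlaps, yet its position may lie strictly inside
   the other leading word; but then the polynomial is a constant. *)
have [Li1|Li1] := eqVneq (Lw G`_i) 1%M.
  by apply: (combo_const Si gi0 Li1) => u; apply: (spol_lt gi0 gj0 e).
have [Lj1|Lj1] := eqVneq (Lw G`_j) 1%M.
  by apply: (combo_const Sj gj0 Lj1) => u; apply: (spol_lt gi0 gj0 e).
have si : (0 < size (Lw G`_i))%N.
  by rewrite lt0n; apply: contra_neq Li1 => /word_size0.
have sj : (0 < size (Lw G`_j))%N.
  by rewrite lt0n; apply: contra_neq Lj1 => /word_size0.
have ntP (x y z t : word) : (x * Lw G`_i * y = z * Lw G`_j * t)%M ->
    nontrivial sigma G (Obs i j x y z t) ->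
    combo S (wlt ^~ (x * Lw G`_i * y)%M) (spol G`_i G`_j x y z t).
  by move=> exy ntx; apply: (nt (Obs i j x y z t)); apply: NTObs_intro.
have ltD p q : (0 < q)%N -> (p < p + q)%N by rewrite -{1}[p]addn0 ltn_add2l.
have core (x y z t : word) : (x * Lw G`_i * y = z * Lw G`_j * t)%M ->
    (x = 1%M \/ z = 1%M) -> (y = 1%M \/ t = 1%M) ->
    (size x < size z + size (Lw G`_j))%N -> (size z < size x + size (Lw G`_i))%N ->
    combo S (wlt ^~ (x * Lw G`_i * y)%M) (spol G`_i G`_j x y z t).
  move=> exy xz1 yt1 lt_x lt_z.
  have ov : has_overlap sigma G (Obs i j x y z t).
    (* The later of the two starting positions lies in both occurrences. *)
    exists (maxn (size x) (size z)); rewrite /= leq_maxl leq_maxr !gtn_max lt_x lt_z.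
    by rewrite (ltD _ _ si) (ltD _ _ sj).
  have [eij|nij] := eqVneq i j; last first.
    apply: ntP => //; split=> //=; rewrite (negPf nij).
    by case: xz1 yt1 => [] ? [] ?; constructor.
  rewrite -eij in exy sj lt_x lt_z ov ntP *.
  (* For equal indices, nested occurrences coincide and give zero. The two staggered cases are zero
     or non-trivial, the second after exchanging its terms. *)
  case: xz1 yt1 => [x1|z1] [y1|t1].
  - move: exy; rewrite x1 y1 mul1m mulm1 => /word_between[-> ->].
    by rewrite spol_refl; apply: combo0.
  - have [z1|z1] := eqVneq z 1%M.
      move: exy; rewrite x1 z1 t1 !mul1m mulm1 => /word_mulr_id->.
      by rewrite spol_refl; apply: combo0.
    have [y1|y1] := eqVneq y 1%M.
      move: exy; rewrite x1 y1 t1 !mul1m !mulm1 => /esym/word_mull_id z0.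
      by rewrite z0 eqxx in z1.
    by apply: ntP => //; split=> //=; rewrite eqxx; split=> //; apply/eqP.
  - have [x1|x1] := eqVneq x 1%M.
      move: exy; rewrite x1 y1 z1 !mul1m mulm1 => /esym/word_mulr_id->.
      by rewrite spol_refl; apply: combo0.
    have [t1|t1] := eqVneq t 1%M.
      move: exy; rewrite t1 y1 z1 !mul1m !mulm1 => /word_mull_id x0.
      by rewrite x0 eqxx in x1.
    rewrite spolN exy; apply: comboN; apply: ntP => //; split=> /=.
      by case: ov => q /=; rewrite andbC => ?; exists q.
    by rewrite eqxx; split=> //; apply/eqP.
  - move: exy; rewrite z1 t1 mul1m mulm1 => /esym/word_between[-> ->].
    by rewrite spol_refl; apply: combo0.
have strip (p q x y z t : word) : a = (p * x)%M -> b = (y * q)%M -> c = (p * z)%M ->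
    d = (t * q)%M -> (x = 1%M \/ z = 1%M) -> (y = 1%M \/ t = 1%M) ->
    (size x < size z + size (Lw G`_j))%N -> (size z < size x + size (Lw G`_i))%N ->
    combo S (wlt ^~ (a * Lw G`_i * b)%M) (spol G`_i G`_j a b c d).
  move=> aE bE cE dE xz1 yt1 lt_x lt_z.
  have exy : (x * Lw G`_i * y = z * Lw G`_j * t)%M.
    by apply: (@word_mul2I _ p q); move: e; rewrite aE bE cE dE !mulmA.
  rewrite aE bE cE dE spol_bimul.
  have -> : (p * x * Lw G`_i * (y * q) = p * (x * Lw G`_i * y) * q)%M by rewrite !mulmA.
  by apply: combo_bimul_lt => //; apply: core.
(* The second occurrence lies entirely to the left of the first. *)
have [ge_a|lt_a] := leqP (size c + size (Lw G`_j)) (size a).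
  have [||m -> ->] := @word_splitl _ (c * Lw G`_j)%M d a (Lw G`_i * b)%M.
  - by rewrite -e mulmA.
  - by rewrite size_wordM.
  rewrite spolN.
  have -> : (c * Lw G`_j * m * Lw G`_i * b = c * Lw G`_j * (m * (Lw G`_i * b)))%M.
    by rewrite !mulmA.
  by apply: comboN; exact: (combo_disjoint c m b Sj Si gj0 gi0).
have [ge_c|lt_c] := leqP (size a + size (Lw G`_i)) (size c).
  have [||m -> ->] := @word_splitl _ (a * Lw G`_i)%M b c (Lw G`_j * d)%M.
  - by rewrite e mulmA.
  - by rewrite size_wordM.
  exact: (combo_disjoint a m d Si Sj gi0 gj0).
(* [a] and [c] are prefixes of one word, so the shorter is their common prefix. *)
have [m [x [z [aE cE xz1]]]] : exists m x z : word,
    [/\ a = (m * x)%M, c = (m * z)%M & x = 1%M \/ z = 1%M].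
  have [le|/ltnW le] := leqP (size a) (size c).
    have [||z -> _] := @word_splitl _ a (Lw G`_i * b)%M c (Lw G`_j * d)%M => //.
      by rewrite !mulmA.
    by exists a, 1%M, z; split=> //; [rewrite mulm1|left].
  have [||x -> _] := @word_splitl _ c (Lw G`_j * d)%M a (Lw G`_i * b)%M => //.
    by rewrite !mulmA.
  by exists c, x, 1%M; split=> //; [rewrite mulm1|right].
have [m' [y [t [bE dE yt1]]]] : exists m y t : word,
    [/\ b = (y * m)%M, d = (t * m)%M & y = 1%M \/ t = 1%M].
  have [le|/ltnW le] := leqP (size b) (size d).
    have [||t -> _] := @word_splitr _ (a * Lw G`_i)%M b (c * Lw G`_j)%M d => //.
    by exists b, 1%M, t; split=> //; [rewrite mul1m|left].
  have [||y -> _] := @word_splitr _ (c * Lw G`_j)%M d (a * Lw G`_i)%M b => //.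
  by exists d, y, 1%M; split=> //; [rewrite mul1m|right].
apply: (strip m m' x y z t) => //.
  by move: lt_a; rewrite aE cE !size_wordM -addnA ltn_add2l.
by move: lt_c; rewrite aE cE !size_wordM -addnA ltn_add2l.
Qed.

End Criterion.
Arguments spol {K X} sigma f%_R g%_R (a b c d)%_M.

(** * Two-sided ideals *)

Section IdealGen.
Variable A : nzRingType.
Implicit Types (S T : set A) (f g : A).

Lemma ideal_gen0 S : ideal_gen S 0.
Proof. by exists [::]; rewrite ?big_nil. Qed.

Lemma ideal_genD S f g : ideal_gen S f -> ideal_gen S g -> ideal_gen S (f + g).
Proof.
move=> [r Sr ->] [r' Sr' ->]; exists (r ++ r'); last by rewrite big_cat.
by move=> t; rewrite mem_cat => /orP[/Sr|/Sr'].
Qed.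

Lemma ideal_genM S f a b : ideal_gen S f -> ideal_gen S (a * f * b).
Proof.
move=> [r Sr ->]; exists [seq (a * t.1.1, t.1.2, t.2 * b) | t <- r].
  by move=> _ /mapP[t /Sr St ->].
rewrite big_map mulr_sumr mulr_suml; apply: eq_bigr => t _ /=.
by rewrite !mulrA.
Qed.

Lemma ideal_genN S f : ideal_gen S f -> ideal_gen S (- f).
Proof. by move=> /(ideal_genM (-1) 1); rewrite mulr1 mulN1r. Qed.

Lemma mem_ideal_gen S f : S f -> ideal_gen S f.
Proof.
move=> Sf; exists [:: (1, f, 1)]; last by rewrite big_seq1 mul1r mulr1.
by move=> t; rewrite inE => /eqP->.
Qed.

Lemma ideal_gen_sub S T : S `<=` ideal_gen T -> ideal_gen S `<=` ideal_gen T.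
Proof.
move=> ST _ [r Sr ->]; elim: r Sr => [|t r IH] Sr.
  by rewrite big_nil; apply: ideal_gen0.
rewrite big_cons; apply: ideal_genD.
  by apply/ideal_genM/ST/Sr; rewrite inE eqxx.
by apply: IH => u ur; apply: Sr; rewrite inE ur orbT.
Qed.

End IdealGen.

(** * Leading word ideals and Buchberger's criterion *)

Section GroebnerBasis.
Variables (K : fieldType) (X : finType) (sigma : rel {fmonom X}).
Hypothesis sigma_ord : word_ordering sigma.
Local Notation word := {fmonom X}.
Local Notation poly := {malg K[{fmonom X}]}.
Local Notation Lw := (Lw sigma).
Implicit Types (f g h : poly) (I S T : set poly) (P : word -> Prop).
Implicit Types (a b u v w : word).

Lemma combo_ideal S P f : combo sigma S P f -> ideal_gen S f.
Proof.
elim=> [|x a g b h Sg _ _ IH]; first exact: ideal_gen0.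
apply: ideal_genD IH; rewrite /bimul 2!scalerAl.
exact/ideal_genM/mem_ideal_gen.
Qed.

Lemma ideal_combo S f : ideal_gen S f -> combo sigma S (fun=> True) f.
Proof.
move=> [r Sr ->]; apply: combo_sum => -[[p g] q] /Sr /= Sg.
rewrite -mulrA [p]monalgE mulr_suml; apply: combo_sum => u _.
rewrite malgU_scale -scalerAl; apply: comboZ.
have := @combo_mulr _ _ sigma S (fun=> True) u g q 1%M Sg.
by rewrite mulr1 -mulrA; apply.
Qed.

(** The generators are words, so expanding the products yields only multiples of them, and
    cancellation creates no new word. *)
Lemma msupp_Lw_ideal S f w : Lw_ideal sigma S f -> w \in msupp f ->
  exists g a b, [/\ S g, g != 0 & w = (a * Lw g * b)%M].
Proof.
move=> [r Sr ->]; elim: r Sr => [|t r IH] Sr; first by rewrite big_nil msupp0 inE.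
rewrite big_cons => /(fsubsetP (msuppD_le _ _)); rewrite inE => /orP[]; last first.
  by apply: IH => u ur; apply: Sr; rewrite inE ur orbT.
have /Sr [g [Sg /eqP g0] <-] : t \in t :: r by rewrite inE eqxx.
move=> /msuppM_le[k1 [b [/msuppM_le[a [u [_ + ->]]] _ ->]]].
by rewrite msuppU1 inE => /eqP->; exists g, a, b.
Qed.

Definition divides_Lw S f := exists g a b, [/\ S g, g != 0 & Lw f = (a * Lw g * b)%M].

Lemma groebner_basisP I S : groebner_basis sigma (ideal_gen I) S <->
  S `<=` ideal_gen I /\ forall f, ideal_gen I f -> f != 0 -> divides_Lw S f.
Proof.
split=> -[SI]; last first.
  move=> dvd; split=> //; apply/seteqP; split; apply: ideal_gen_sub.
    by move=> _ [g [Sg g0] <-]; apply: mem_ideal_gen; exists g => //; split=> //; apply: SI.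
  move=> _ [f [If /eqP f0] <-]; have [g [a [b [Sg g0 ->]]]] := dvd f If f0.
  have -> : << a * Lw g * b >> = << a >> * << Lw g >> * << b >> :> poly.
    by rewrite !malgUM !mulr1.
  by apply/ideal_genM/mem_ideal_gen; exists g => //; split=> //; apply/eqP.
move=> eSI; split=> // f If f0; apply: (@msupp_Lw_ideal S << Lw f >>).
  by rewrite eSI; apply: mem_ideal_gen; exists f => //; split=> //; apply/eqP.
by rewrite msuppU1 inE.
Qed.

Lemma buchberger_criterion S : (forall g, S g -> g != 0) ->
  critical_pairs sigma S -> groebner_basis sigma (ideal_gen S) S.
Proof.
move=> S0 SP; apply/groebner_basisP; split; first exact: mem_ideal_gen.
move=> f /ideal_combo Cf f0.
have [a [g [b [Sg fg]]]] := Lw_combo sigma_ord S0 SP f0 Cf.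
by exists g, a, b; split=> //; apply: S0.
Qed.

End GroebnerBasis.

(** * The division algorithm *)

Lemma addr_split3 (V : zmodType) (u v p r : V) : v + p - r = v - u + p - r + u.
Proof. by rewrite addrAC [in RHS]addrAC [v - u + p]addrAC subrK addrAC. Qed.

Lemma addr_shift (V : zmodType) (u v p r : V) : v - u + (p + u) - r = v + p - r.
Proof. by rewrite [p + u]addrC addrA subrK. Qed.

Section Division.
Variables (K : fieldType) (X : finType) (sigma : rel {fmonom X}).
Hypothesis sigma_ord : word_ordering sigma.
Local Notation word := {fmonom X}.
Local Notation poly := {malg K[{fmonom X}]}.
Local Notation Lw := (Lw sigma).
Implicit Types (f g p r : poly) (G : seq poly) (P : word -> Prop).
Implicit Types (a b u v w : word).

(** [f + p] changes only in reduction steps, by a multiple of a basis element whose leading word is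
    that of [f] and so satisfies [P]. As [P] is closed downwards, the support of the new [f]
    satisfies it too. *)
Lemma division_combo G f p r P : (forall u v, sigma u v -> P v -> P u) ->
  division sigma G f p r -> (forall u, u \in msupp f -> P u) ->
  combo sigma [set` G] P (f + p - r) /\
  ((forall u, u \in msupp p -> P u) -> forall u, u \in msupp r -> P u).
Proof.
move=> Pdown; elim=> {f p r} [p|f p r i w w' f0 [iG _] _ fw _ IH|f p r f0 _ _ IH] Pf.
- by rewrite add0r subrr; split=> //; apply: combo0.
- have Pw : P (w * Lw G`_i * w')%M by rewrite -fw; apply/Pf/Lw_in.
  case: IH => [u|C Pr].
    move=> /(fsubsetP (msuppB_le _ _)); rewrite inE => /orP[/Pf //|].
    move=> /(fsubsetP (msuppZ_le _ _)) /(msupp_bimul_le sigma_ord) uw.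
    exact: Pdown uw Pw.
  split=> //; rewrite (addr_split3 (Lc sigma f / Lc sigma G`_i *: bimul w G`_i w')).
  by apply: (comboD C); apply: combo1 => //; rewrite /= mem_nth.
have Pm u : u \in msupp << Lc sigma f *g Lw f >> -> P u.
  move=> /(fsubsetP msuppU_le); rewrite inE => /eqP->.
  by apply/Pf/Lw_in.
case: IH => [u|C Pr].
  by move=> /(fsubsetP (msuppB_le _ _)); rewrite inE => /orP[/Pf|/Pm].
split; first by rewrite addr_shift in C.
move=> Pp; apply: Pr => u.
by move=> /(fsubsetP (msuppD_le _ _)); rewrite inE => /orP[/Pp|/Pm].
Qed.

(** A word enters [p] only when no leading word divides it. *)
Lemma division_irreducible G f p r : division sigma G f p r ->
  (forall u, u \in msupp p -> forall g a b, g \in G -> u <> (a * Lw g * b)%M) ->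
  forall u, u \in msupp r -> forall g a b, g \in G -> u <> (a * Lw g * b)%M.
Proof.
elim=> {f p r} [//|//|f p r f0 irr _ IH] Pp; apply: IH => u.
move=> /(fsubsetP (msuppD_le _ _)); rewrite inE => /orP[/Pp //|].
move=> /(fsubsetP msuppU_le); rewrite inE => /eqP-> g a b gG e.
by apply: (irr (index g G)); split; [rewrite index_mem|exists a, b; rewrite nth_index].
Qed.

End Division.

(** * Invariants of an execution *)

Section Execution.
Variables (K : fieldType) (X : finType) (sigma : rel {fmonom X}).
Hypothesis sigma_ord : word_ordering sigma.
Local Notation word := {fmonom X}.
Local Notation poly := {malg K[{fmonom X}]}.
Local Notation Lw := (Lw sigma).
Local Notation NTObs := (NTObs sigma).
Local Notation Spoly := (Spoly sigma).

(** The conditions involve only the entries [i] and [j], which an extension of the list leaves in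
    place. *)
Lemma NTObs_prefix (G T : seq poly) i j : (i < size G)%N -> (j < size G)%N ->
  NTObs (G ++ T) i j = NTObs G i j.
Proof.
move=> iG jG; apply/seteqP; rewrite /Defs.NTObs /obstruction /nontrivial /has_overlap.
rewrite /obs_elt size_cat; split=> o /= [oio ojo []]; rewrite oio ojo !nth_cat iG jG //.
by move=> _ _ e nz nt; split=> //; split=> //; rewrite ltn_addr.
Qed.

Variables (R : nat -> set (obs X)) (G0 : seq poly).
Variables (st : nat -> state K X) (sel : nat -> obs X).
Hypothesis G0_neq0 : forall g, g \in G0 -> g != 0.
Hypothesis exec : execution sigma R G0 st sel.
Local Notation B k := (basis (st k)).
Local Notation I := (ideal_gen [set` G0]).

(** A stopped execution counts as a third outcome, so inductions over the stages need a single case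
    analysis. *)
Variant pass_spec k : state K X -> Prop :=
| PassStop of pending (st k) = set0 : pass_spec k (st k)
| PassZero of pending (st k) (sel k) &
    normal_remainder sigma (B k) (Spoly (B k) (sel k)) 0 :
    pass_spec k (State (B k) (pending (st k) `\ sel k))
| PassNew g of pending (st k) (sel k) &
    normal_remainder sigma (B k) (Spoly (B k) (sel k)) g & g != 0 :
    pass_spec k (State (rcons (B k) g)
      ((pending (st k) `\ sel k) `|` (new_obs sigma (rcons (B k) g) `\` R k))).

Lemma execution_passP k : pass_spec k (st k.+1).
Proof.
have [p0|/set0P pn0] := eqVneq (pending (st k)) set0.
  by rewrite (execution_stop exec p0); apply: PassStop.
have [pk [g nr ->]] := execution_pass exec pn0.
by case: eqVneq nr => [->|g0] nr; [apply: PassZero|apply: PassNew].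
Qed.

Lemma basis_prefixS k : exists T, B k.+1 = B k ++ T.
Proof.
case: execution_passP => [_|_ _|g _ _ _] /=; try by exists [::]; rewrite cats0.
by exists [:: g]; rewrite cats1.
Qed.

Lemma basis_prefix k m : (k <= m)%N -> exists T, B m = B k ++ T.
Proof.
elim: m => [|m IH]; first by rewrite leqn0 => /eqP->; exists [::]; rewrite cats0.
rewrite leq_eqVlt => /predU1P[->|/IH[T BT]]; first by exists [::]; rewrite cats0.
by have [T' ->] := basis_prefixS m; exists (T ++ T'); rewrite BT catA.
Qed.

Lemma sub_basis k m g : (k <= m)%N -> g \in B k -> g \in B m.
Proof. by move=> /basis_prefix[T ->] gk; rewrite mem_cat gk. Qed.

Lemma nth_basis k m i : (i < size (B k))%N -> (i < size (B m))%N -> (B m)`_i = (B k)`_i.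
Proof.
move=> ik im; have [/basis_prefix[T]|/basis_prefix[T]] := orP (leq_total k m).
  by move=> ->; rewrite nth_cat ik.
by move=> ->; rewrite nth_cat im.
Qed.

Lemma basis_neq0 k g : g \in B k -> g != 0.
Proof.
elim: k g => [|k IH] g; first by rewrite (execution_init exec); apply: G0_neq0.
case: execution_passP => [_|_ _|h _ _ h0] /=; try exact: IH.
by rewrite mem_rcons inE => /predU1P[->|/IH].
Qed.

Lemma nth_basis_neq0 k i : (i < size (B k))%N -> (B k)`_i != 0.
Proof. by move=> ik; apply: (@basis_neq0 k); apply: mem_nth. Qed.

Lemma pendingP k o : pending (st k) o ->
  [/\ (oi o <= oj o)%N, (oj o < size (B k))%N & NTObs (B k) (oi o) (oj o) o].
Proof.
elim: k => [|k IH].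
  by rewrite (execution_init exec) => -[i [j [/andP[ij jG] o0]]]; case: (o0) => -> ->.
case: execution_passP => [_|_ _|g _ _ _] /=; first exact: IH.
  by case=> /IH.
case=> [[/IH[ij jG oG] _]|[[i]]].
  rewrite -cats1 size_cat ltn_addr //; split=> //.
  by rewrite NTObs_prefix // (leq_ltn_trans ij).
rewrite size_rcons /= => iG oG _; case: (oG) => oio ojo _ _.
by rewrite oio ojo; split=> //; rewrite -ltnS.
Qed.

Lemma Spoly_ideal k o : (oi o < size (B k))%N -> (oj o < size (B k))%N ->
  [set` B k] `<=` I -> I (Spoly (B k) o).
Proof.
move=> ik jk BI.
have mem (x : K) a b i : (i < size (B k))%N -> I (x *: bimul a (B k)`_i b).
  move=> iB; rewrite /bimul 2!scalerAl; apply/ideal_genM/BI; exact: mem_nth.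
by apply: ideal_genD; [|apply: ideal_genN]; apply: mem.
Qed.

Lemma normal_remainder_ideal G f r : [set` G] `<=` I ->
  normal_remainder sigma G f r -> I f -> I r.
Proof.
move=> GI nr If.
have [C _] := division_combo (P := fun=> True) sigma_ord (fun _ _ _ => id) nr (fun _ _ => Logic.I).
have /(ideal_gen_sub GI)/ideal_genN := combo_ideal C.
by rewrite addr0 opprB => /ideal_genD/(_ If); rewrite subrK.
Qed.

Lemma basis_ideal k : [set` B k] `<=` I.
Proof.
elim: k => [|k IH]; first by rewrite (execution_init exec); apply: mem_ideal_gen.
case: execution_passP => [_|_ _|g pk nr _] //= h /=.
rewrite mem_rcons inE => /predU1P[->|/IH //].
have [ij jk _] := pendingP pk.
by apply: (normal_remainder_ideal IH nr); apply: Spoly_ideal => //; apply: leq_ltn_trans jk.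
Qed.

(** * The union of all bases and the resolution of obstructions *)

Definition limit : set poly := [set g | exists k, g \in B k].

(** Polynomials of every stage may be used, so this depends on [k] only through the two entries
    named by the indices. *)
Definition resolved k o := combo sigma limit
  (wlt sigma ^~ (wi o * Lw (B k)`_(oi o) * wi' o)%M) (Spoly (B k) o).

Lemma resolved_stage k m o : (oi o < size (B k))%N -> (oj o < size (B k))%N ->
  (oi o < size (B m))%N -> (oj o < size (B m))%N -> resolved m o -> resolved k o.
Proof.
by move=> ik jk im jm; rewrite /resolved /Defs.Spoly !(@nth_basis k m).
Qed.

(** By fairness [o] is selected at some stage [m]. Division writes S - S' with terms below the
    common word, and the remainder S' is zero or, once appended to the basis, itself such a term. *)
Lemma pending_resolved k o : pending (st k) o -> resolved k o.
Proof.
move=> pk; have [ij jk oG] := pendingP pk.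
have ik := leq_ltn_trans ij jk.
have [m [km pm selm]] := execution_fair exec pk.
have [_ jm [_ _ [im _ e _] _]] := pendingP pm.
apply: (@resolved_stage k m) => //; rewrite /resolved.
have low u : u \in msupp (Spoly (B m) o) ->
    wlt sigma u (wi o * Lw (B m)`_(oi o) * wi' o)%M.
  by apply: spol_lt => //; apply: nth_basis_neq0.
have down u v : sigma u v ->
    wlt sigma v (wi o * Lw (B m)`_(oi o) * wi' o)%M ->
    wlt sigma u (wi o * Lw (B m)`_(oi o) * wi' o)%M by apply: le_wlt_trans.
have limS : [set` B m] `<=` limit by move=> g gm; exists m.
have limS1 : [set` B m.+1] `<=` limit by move=> g gm; exists m.+1.
move: low down limS1; rewrite -selm.
case: execution_passP => [p0|_ nr|g _ nr g0] low down limS1.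
- by move: pm; rewrite p0.
- have [C _] := division_combo sigma_ord down nr low.
  by rewrite addr0 subr0 in C; apply: sub_combo C.
have [C low'] := division_combo sigma_ord down nr low.
have {}low' : forall u, u \in msupp g -> _ := low' _.
rewrite addr0 in C; rewrite -(subrK g (Spoly _ _)).
apply: comboD; first by apply: sub_combo C.
rewrite -[g]bimul11 -[bimul 1 g 1]scale1r; apply: combo1.
  by apply: limS1; rewrite /= mem_rcons inE eqxx.
rewrite mul1m mulm1; apply: low'; first by move=> u; rewrite msupp0 inE.
exact: Lw_in.
Qed.

(** The obstructions of [i] and [j] become pending together with entry [j], initially or when it is
    appended, unless that pass leaves them out. *)
Lemma NTObs_pending k i j o : (i <= j)%N -> (j < size (B k))%N ->
  NTObs (B k) i j o -> (exists m, pending (st m) o) \/ exists m, R m o.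
Proof.
move=> ij; elim: k => [|k IH].
  rewrite (execution_init exec) /= => jG oG.
  by left; exists 0%N; rewrite (execution_init exec); exists i, j; rewrite ij.
have := erefl (st k.+1); case: {2 3 4}_ / execution_passP => [_|_ _|g _ _ g0] st1 //=.
rewrite size_rcons ltnS leq_eqVlt => /predU1P[jE|jk]; last first.
  by rewrite -cats1 NTObs_prefix ?(leq_ltn_trans ij) //; apply: IH.
move=> oG; have [Ro|nRo] := pselect (R k o); first by right; exists k.
left; exists k.+1; rewrite st1; right; split=> //; exists i; rewrite size_rcons.
  by rewrite ltnS -jE.
by rewrite /= -jE.
Qed.

(** Pending obstructions have ordered indices, hence the minimum and maximum. Only removed
    obstructions of this very pair are assumed resolved, which keeps the final argument from being
    circular. *)
Lemma limit_pair k i j : (i < size (B k))%N -> (j < size (B k))%N ->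
  (forall o, NTObs (B k) (minn i j) (maxn i j) o -> (exists m, R m o) ->
     resolved k o) ->
  forall a b c d, (a * Lw (B k)`_i * b = c * Lw (B k)`_j * d)%M ->
  combo sigma limit (wlt sigma ^~ (a * Lw (B k)`_i * b)%M)
    (spol sigma (B k)`_i (B k)`_j a b c d).
Proof.
wlog ij : i j / (i <= j)%N => [hwlog ik jk Rres a b c d e|ik jk].
  have [|/ltnW ji] := leqP i j; first by move=> /hwlog; apply.
  rewrite spolN e; apply: comboN.
  by apply: hwlog => //; rewrite minnC maxnC.
rewrite (minn_idPl ij) (maxn_idPr ij) => Rres.
have lim n : (n < size (B k))%N -> limit (B k)`_n by move=> nk; exists k; apply: mem_nth.
have [ni nj] := (nth_basis_neq0 ik, nth_basis_neq0 jk).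
apply: (critical_pair sigma_ord ik jk ni nj (lim i ik) (lim j jk)) => o oG.
have [oi_ oj_ _ _] := oG.
have [[m pm]|Rm] := NTObs_pending ij jk oG; last first.
  by have := Rres o oG Rm; rewrite /resolved oi_.
have [ijm jm _] := pendingP pm; have im := leq_ltn_trans ijm jm.
have := pending_resolved pm; rewrite -oi_ -oj_ in ik jk *.
exact: resolved_stage.
Qed.

Lemma limit_groebner :
  (forall k o, (exists m, R m o) -> NTObs (B k) (oi o) (oj o) o -> resolved k o) ->
  enumerates_groebner sigma I st.
Proof.
move=> Rres.
have lim_neq0 g : limit g -> g != 0 by move=> [k]; apply: basis_neq0.
have limI : limit `<=` I by move=> g [k]; apply: basis_ideal.
have Ilim : I = ideal_gen limit.
  apply/seteqP; split; apply: ideal_gen_sub => // g gG.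
  by apply: mem_ideal_gen; exists 0%N; rewrite (execution_init exec).
rewrite /enumerates_groebner Ilim; apply: buchberger_criterion => //.
move=> f g a b c d [k1 fk] [k2 gk].
(* Bases grow, so both polynomials are present at the later stage. *)
have {}fk := sub_basis (leq_maxl k1 k2) fk; have {}gk := sub_basis (leq_maxr k1 k2) gk.
move: (maxn k1 k2) fk gk => k fk gk.
rewrite -(nth_index 0 fk) -(nth_index 0 gk); apply: limit_pair; rewrite ?index_mem // => o oG Ro.
by apply: Rres => //; case: (oG) => -> -> _ _.
Qed.

(** * Termination *)

Lemma basis_stable k :
  (forall f, I f -> f != 0 -> divides_Lw sigma [set` B k] f) -> B k.+1 = B k.
Proof.
case: execution_passP => [_|_ _|g pk nr g0] //= dvd.
have [ij jk _] := pendingP pk.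
have Ig : I g.
  apply: (normal_remainder_ideal (@basis_ideal k) nr).
  by apply: Spoly_ideal (@basis_ideal k) => //; apply: leq_ltn_trans jk.
(* A leading word of the basis divides that of the new remainder, against irreducibility. *)
have [h [a [b [hB _ e]]]] := dvd g Ig g0.
have irr0 u : u \in msupp (0 : poly) -> forall h a b, h \in B k -> u <> (a * Lw h * b)%M.
  by rewrite msupp0 inE.
by case: (division_irreducible nr irr0 (Lw_in sigma g0) hB e).
Qed.

Lemma pending_stable k : B k.+1 = B k ->
  pending (st k.+1) = pending (st k) `\ sel k.
Proof.
case: execution_passP => [p0|_ _|g _ _ _] //=; first by rewrite p0 set0D.
by move=> /(congr1 size) /eqP; rewrite size_rcons eqn_leq ltnn.
Qed.

(** Two overlapping leading words cover the common word of a non-trivial obstruction, so no cofactor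
    is longer than twice the longest leading word. *)
Lemma NTObs_finite (G : seq poly) : exists (T : finType) (F : T -> obs X),
  forall i j o, NTObs G i j o -> exists t, o = F t.
Proof.
pose N := (\max_(g <- G) size (Lw g))%N; pose M := (N + N)%N.
pose T := ('I_(size G) * 'I_(size G) *
  (M.-bseq X * M.-bseq X * (M.-bseq X * M.-bseq X)))%type.
exists T, (fun t : T => Obs t.1.1 t.1.2 (FMonom t.2.1.1) (FMonom t.2.1.2)
  (FMonom t.2.2.1) (FMonom t.2.2.2)) => i j [i' j' a b c d].
rewrite /Defs.NTObs /= => -[_ _ [/= iG jG e _] [[q /=] /andP[/andP[ai qi] /andP[cj qj]] nt]].
have LN k : (k < size G)%N -> (size (Lw G`_k) <= N)%N.
  by move=> kG; apply: (@leq_bigmax_seq _ _ _ (fun g => size (Lw g))) => //; apply: mem_nth.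
have W : (size (a * Lw G`_i' * b)%M <= M)%N.
  (* The shared position bounds [a] by the length of the other leading word. *)
  have form1 : b = 1%M -> c = 1%M -> (size (a * Lw G`_i' * b)%M <= M)%N.
    move=> -> c1; rewrite mulm1 size_wordM leq_add ?LN // (leq_trans ai) //.
    by rewrite c1 size_word1 in qj; rewrite (leq_trans (ltnW qj)) // LN.
  have form2 : a = 1%M -> d = 1%M -> (size (a * Lw G`_i' * b)%M <= M)%N.
    move=> a1 d1; rewrite e d1 mulm1 size_wordM leq_add ?LN // (leq_trans cj) //.
    by rewrite a1 size_word1 in qi; rewrite (leq_trans (ltnW qi)) // LN.
  move: nt; case: eqP => [_ [a1 d1 _ _]|_]; first exact: form2.
  case=> -[]; [exact: form1|exact: form2| |].
    by move=> c1 d1; rewrite e c1 d1 mulm1 mul1m (leq_trans (LN _ jG)) // leq_addr.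
  by move=> a1 b1; rewrite a1 b1 mulm1 mul1m (leq_trans (LN _ iG)) // leq_addr.
have W' := W; rewrite e in W'.
have aM : (size a <= M)%N by apply: leq_trans W; rewrite !size_wordM -addnA leq_addr.
have bM : (size b <= M)%N by apply: leq_trans W; rewrite size_wordM leq_addl.
have cM : (size c <= M)%N by apply: leq_trans W'; rewrite !size_wordM -addnA leq_addr.
have dM : (size d <= M)%N by apply: leq_trans W'; rewrite size_wordM leq_addl.
by exists (Ordinal iG, Ordinal jG, (Bseq aM, Bseq bM, (Bseq cM, Bseq dM))); rewrite /= !fmK.
Qed.

(** Once the basis is constant nothing is added, so a selected obstruction never returns, and
    fairness selects each of the finitely many candidates. *)
Lemma pending_empties m : (forall k, (m <= k)%N -> B k.+1 = B k) ->
  exists2 k, (m <= k)%N & pending (st k) = set0.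
Proof.
move=> stable; have [T [F F_onto]] := NTObs_finite (B m).
have pend k : (m <= k)%N -> pending (st k.+1) = pending (st k) `\ sel k.
  by move=> mk; apply/pending_stable/stable.
have shrink k l : (m <= k)%N -> (k <= l)%N -> pending (st l) `<=` pending (st k).
  move=> mk; elim: l => [|l IH]; first by rewrite leqn0 => /eqP->.
  rewrite leq_eqVlt => /predU1P[-> //|kl]; rewrite pend ?(leq_trans mk) //.
  by move=> o [/(IH kl)].
have [k mk none] : exists2 k, (m <= k)%N & forall t, t \in enum T -> ~ pending (st k) (F t).
  elim: (enum T) => [|t s [k mk IH]]; first by exists m.
  have [pt|npt] := pselect (pending (st k) (F t)); last first.
    by exists k => // u; rewrite inE => /predU1P[->|/IH].
  have [l [kl _ selt]] := execution_fair exec pt.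
  exists l.+1; first by rewrite ltnW // ltnS (leq_trans mk).
  move=> u; rewrite inE => /predU1P[->|/IH nu].
    by rewrite pend ?(leq_trans mk) // selt => -[_]; apply.
  by move=> /(shrink _ _ mk (leqW kl)).
exists k => //; apply/seteqP; split=> // o pk.
have /pendingP[_ _ /F_onto[t oF]] := shrink _ _ (leqnn m) mk _ pk.
by apply: (none t); rewrite ?mem_enum // -oF.
Qed.

Lemma stops_of_enumerates : enumerates_groebner sigma I st ->
  has_finite_groebner sigma I -> stops_with_groebner sigma I st.
Proof.
move=> /groebner_basisP[_ limP] [H /groebner_basisP[HI HP]].
(* Each non-zero element of [H] has its leading word divided by one that occurs at some stage; the
   largest of these stages serves for all. *)
have [m mP] : exists m, forall h, h \in H -> h != 0 -> divides_Lw sigma [set` B m] h.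
  elim: H HI {HP} => [|h H IH] HI; first by exists 0%N.
  have [|m mP] := IH; first by move=> g gH; apply: HI; rewrite /= inE gH orbT.
  have [h0|h0] := eqVneq h 0.
    by exists m => g; rewrite inE => /predU1P[->|/mP //]; rewrite h0 eqxx.
  have [|g [a [b [[k gk] g0 e]]]] := limP h _ h0; first by apply: HI; rewrite /= inE eqxx.
  exists (maxn m k) => f; rewrite inE => /predU1P[-> _|/mP/[apply]].
    by exists g, a, b; split=> //=; apply: sub_basis gk; apply: leq_maxr.
  move=> [p [a' [b' [pm p0 e']]]].
  by exists p, a', b'; split=> //=; apply: sub_basis pm; apply: leq_maxl.
have dvd k f : (m <= k)%N -> I f -> f != 0 -> divides_Lw sigma [set` B k] f.
  move=> mk If f0; have [h [a [b [hH h0 e]]]] := HP f If f0.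
  have [g [c [d [gm g0 e']]]] := mP h hH h0.
  exists g, (a * c)%M, (d * b)%M; split=> //; first exact: sub_basis gm.
  by rewrite e e' !mulmA.
have [|k mk p0] := @pending_empties m.
  by move=> k mk; apply: basis_stable => f; apply: dvd.
exists k; split=> //; apply/groebner_basisP; split; first exact: basis_ideal.
by move=> f; apply: dvd.
Qed.

End Execution.

(** * Resolution of the removed obstruction *)

Theorem proposition3p7 (K : fieldType) (X : finType) (sigma : rel {fmonom X})
    (G0 : seq {malg K[{fmonom X}]}) (st : nat -> state K X)
    (sel : nat -> obs X) (t : nat) (gs : {malg K[{fmonom X}]})
    (o1 o2 : obs X) (i j : nat) (w_i w_i' u_s u_s' w_j w_j' v_s v_s' w w' : {fmonom X})
    (I := ideal_gen [set` G0]) (s := size (basis (st t)))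
    (G := basis (st t.+1)) :
  word_ordering sigma ->
  (1 <= size G0)%N ->
  (forall g, g \in G0 -> g != 0) ->
  execution sigma (fun k => if k == t then [set o1] else set0) G0 st sel ->
  G = rcons (basis (st t)) gs ->
  o1 = Obs i s w_i w_i' u_s u_s' ->
  o2 = Obs j s w_j w_j' v_s v_s' ->
  NTObs sigma G i s o1 ->
  NTObs sigma G j s o2 ->
  obs_elt sigma G o1 <> obs_elt sigma G o2 ->
  u_s = (w * v_s)%M ->
  u_s' = (v_s' * w')%M ->
  (j < i)%N \/ [/\ i = j, (w * w')%M = 1%M & sigma w_j w_i && (w_j != w_i)] ->
  enumerates_groebner sigma I st /\
  (has_finite_groebner sigma I -> stops_with_groebner sigma I st).
Proof.
move=> sigma_ord _ G0_neq0 exec GE o1E o2E NT1 NT2 ne12 uE uE' cond.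
suff lim : enumerates_groebner sigma I st.
  by split; [exact: lim|exact: (stops_of_enumerates sigma_ord exec lim)].
have removed o : (exists m, (if m == t then [set o1] else set0) o) -> o = o1.
  by case=> m; case: eqP.
have sG : size G = s.+1 by rewrite GE size_rcons.
have iG : (i < size G)%N by case: NT1 => _ _ []; rewrite o1E.
have jG : (j < size G)%N by case: NT2 => _ _ []; rewrite o2E.
have ssG : (s < size G)%N by rewrite sG.
have e1 : (w_i * Lw sigma G`_i * w_i' = u_s * Lw sigma G`_s * u_s')%M.
  by case: NT1 => _ _ []; rewrite o1E.
have e2 : (w_j * Lw sigma G`_j * w_j' = v_s * Lw sigma G`_s * v_s')%M.
  by case: NT2 => _ _ []; rewrite o2E.
(* The multiple of [o2] by [w] and [w'] has the common word of [o1], so there [G] has an obstruction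
   between its entries [i] and [j]. *)
have e12 : (w_i * Lw sigma G`_i * w_i' = w * w_j * Lw sigma G`_j * (w_j' * w'))%M.
  rewrite e1 uE uE'.
  have -> : (w * w_j * Lw sigma G`_j * (w_j' * w') =
    w * (w_j * Lw sigma G`_j * w_j') * w')%M by rewrite !mulmA.
  by rewrite e2 !mulmA.
(* In case (a) the smaller index of the pair is [j], not [i]. In case (b) the pair would have to be
   [s] with itself; then [o1] and [o2] are self-obstructions, whose left cofactors [w_i] and [w_j]
   both equal 1, against w_i > w_j. *)
have o1_not_ij o : NTObs sigma G (minn i j) (maxn i j) o -> o <> o1.
  case=> oio ojo _ _ oo1; move: oio ojo; rewrite oo1 o1E /= => i_min s_max.
  case: cond => [ji|[ij _ /andP[_ /eqP]]].
    by rewrite (minn_idPr (ltnW ji)) in i_min; rewrite i_min ltnn in ji.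
  apply; rewrite -ij maxnn in s_max; move: NT1 NT2; rewrite o1E o2E -ij -s_max.
  by case=> _ _ _ [_ /=]; rewrite eqxx => -[-> _ _ _] [_ _ _ [_ /=]]; rewrite eqxx => -[->].
apply: (limit_groebner sigma_ord G0_neq0 exec) => k o /removed-> NTk.
have C12 : combo sigma (limit st) (wlt sigma ^~ (w_i * Lw sigma G`_i * w_i')%M)
    (spol sigma G`_i G`_j w_i w_i' (w * w_j) (w_j' * w')).
  refine (limit_pair sigma_ord G0_neq0 exec iG jG _ e12) => o' NTo' /removed o'1.
  by case: (o1_not_ij o' NTo' o'1).
(* [o2] differs from [o1], so it becomes pending and is eventually selected. *)
have C2 : resolved sigma st t.+1 o2.
  have js : (j <= s)%N by rewrite -ltnS -sG.
  have := NTObs_pending (k := t.+1) exec js ssG NT2.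
  case=> [[m pm]|/removed o21]; last by case: ne12; rewrite o21.
  have [ijm jm _] := pendingP exec pm; have im := leq_ltn_trans ijm jm.
  have Cm := pending_resolved sigma_ord G0_neq0 exec pm.
  by refine (resolved_stage (k := t.+1) exec _ _ im jm Cm); rewrite o2E.
have C1 : resolved sigma st t.+1 o1.
  rewrite /resolved o1E /=.
  (* The relation o1 = w o2 w' + o, read on S-polynomials. *)
  have -> : Spoly sigma G (Obs i s w_i w_i' u_s u_s') =
    bimul w (Spoly sigma G o2) w' + spol sigma G`_i G`_j w_i w_i' (w * w_j) (w_j' * w').
    rewrite o2E -[Spoly _ _ _]/(spol _ _ _ _ _ _ _).
    rewrite (spol_trans _ _ G`_j _ _ _ (w * w_j)%M (w_j' * w')%M).
    by rewrite uE uE' spol_bimul.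
  apply: comboD; last exact: C12.
  rewrite -/G e12.
  have -> : (w * w_j * Lw sigma G`_j * (w_j' * w') =
    w * (w_j * Lw sigma G`_j * w_j') * w')%M by rewrite !mulmA.
  by apply: (combo_bimul_lt sigma_ord); rewrite o2E in C2 *; exact: C2.
(* At the arbitrary stage [k] the indices name the same polynomials as at stage [t.+1]. *)
case: (NTk) => _ _ [ik jk _ _] _.
by refine (resolved_stage (m := t.+1) exec ik jk _ _ C1); rewrite o1E.
Qed.
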